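(* The minimum integer $n$ such that for every $2$-coloring of $[1,n] \times [1,n]$ there exist $a,b,x,d \in \mathbb{Z}^+$ with $(a,x)$, $(b,x+d)$, and $(a+b,x+2d)$ all in $[1,n]\times[1,n]$ and all of the same color, is $n=9$.
   Context: $[1,n]=\{1,2,\dots,n\}$. *)

(* Defs.v *)
From mathcomp Require Import all_boot.

Set Implicit Arguments.
Unset Strict Implicit.
Unset Printing Implicit Defensive.

Definition grid (n : nat) : Type :=
  {p : nat * nat | (1 <= p.1 <= n) && (1 <= p.2 <= n)}.

(* For n = 0 the grid is empty, so [forces_mono 0] is false, as it is for
   negative integers n; minimizing over nat loses nothing. *)
Definition forces_mono (n : nat) : Prop :=
  forall c : grid n -> 'I_2,
    exists a b x d : nat,
      [/\ 0 < a, 0 < b, 0 < x & 0 < d] /\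
      exists p q r : grid n,
        [/\ val p = (a, x), val q = (b, x + d) & val r = (a + b, x + 2 * d)] /\
        (c p = c q /\ c q = c r).

(* Main.v *)
Require Import Defs.
From mathcomp Require Import all_boot.

(** For the upper bound, call the colour of [(5, 5)] white. Refuting the
    opposite colour each time, one finds that in a colouring of the 9 x 9 grid
    without a monochromatic triple [(1, 3)] is black, [(3, 5)] white, [(2, 3)]
    black, [(1, 2)] and [(4, 6)] white, and these six colours are inconsistent.
    The lower bound is an explicit colouring of the 8 x 8 grid. *)

Definition non_mono (f : nat -> nat -> bool) (a b x d : nat) : bool :=
  ~~ ((f a x == f b (x + d)) && (f b (x + d) == f (a + b) (x + 2 * d))).

(** A boolean with bounded ranges, so that a concrete [f] can be checked by evaluation. The guard
    puts the third point in the grid, which forces the other two in. *)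
Definition mono_free (n : nat) (f : nat -> nat -> bool) : bool :=
  all (fun a => all (fun b => all (fun x => all (fun d =>
      (a + b <= n) && (x + 2 * d <= n) ==> non_mono f a b x d)
    (iota 1 n)) (iota 1 n)) (iota 1 n)) (iota 1 n).

Lemma mono_freeP {n : nat} {f : nat -> nat -> bool} :
  mono_free n f -> forall a b x d,
  [&& 0 < a, 0 < b, 0 < x, 0 < d, a + b <= n & x + 2 * d <= n] ->
  non_mono f a b x d.
Proof.
move=> mf a b x d /and5P[a0 b0 x0 d0 /andP[hab hxd]].
(* Each variable is a summand of [a + b] or [x + 2 * d], hence at most [n]. *)
have range k m : 0 < k -> k + m <= n -> k \in iota 1 n.
  by move=> k0 hk; rewrite mem_iota k0 add1n ltnS (leq_trans (leq_addr m k)).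
have hba : b + a <= n by rewrite addnC.
have hd : d + (x + d) <= n by rewrite addnCA addnn -mul2n.
move/allP/(_ a (range _ _ a0 hab)): mf => /allP/(_ b (range _ _ b0 hba)).
move=> /allP/(_ x (range _ _ x0 hxd)) /allP/(_ d (range _ _ d0 hd)).
by rewrite hab hxd.
Qed.

Lemma mono_freePn {n : nat} {f : nat -> nat -> bool} :
  ~~ mono_free n f -> exists a b x d, [/\ 0 < a, 0 < b, 0 < x & 0 < d] /\
  [/\ a + b <= n, x + 2 * d <= n & ~~ non_mono f a b x d].
Proof.
case/allPn=> a + /allPn[b + /allPn[x + /allPn[d]]].
rewrite !mem_iota => /andP[d0 _] /andP[x0 _] /andP[b0 _] /andP[a0 _].
by rewrite negb_imply => /andP[/andP[hab hxd] mono]; exists a, b, x, d.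
Qed.

Lemma coloring9_white_not_mono_free (f : nat -> nat -> bool) :
  f 5 5 = false -> ~~ mono_free 9 f.
Proof.
move=> h55; apply/negP => /mono_freeP nm.
have h13 : f 1 3 = true.
  (* White is [false]. Here and below, under the refuted colour, each listed triple in turn forces
     one new point, and the last triple is monochromatic. *)
  move: (nm 1 4 3 1 isT) (nm 1 5 3 2 isT) (nm 2 4 1 3 isT)
    (nm 2 3 1 2 isT) (nm 2 1 1 2 isT) (nm 3 3 3 2 isT).
  rewrite /non_mono /= h55.
  by do !(case: (f _ _) => //=).
have h35 : f 3 5 = false.
  move: (nm 2 1 1 2 isT) (nm 1 2 3 1 isT) (nm 1 3 3 2 isT)
    (nm 2 2 1 3 isT).
  rewrite /non_mono /= h13.
  by do !(case: (f _ _) => //=).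
have h23 : f 2 3 = true.
  move: (nm 3 2 1 2 isT) (nm 2 3 3 1 isT) (nm 1 3 3 1 isT)
    (nm 2 4 3 2 isT) (nm 3 3 1 3 isT).
  rewrite /non_mono /= h55 h13.
  by do !(case: (f _ _) => //=).
have h12 : f 1 2 = false.
  move: (nm 1 1 1 1 isT) (nm 1 1 2 1 isT) (nm 2 3 4 1 isT)
    (nm 1 5 3 3 isT) (nm 1 5 1 4 isT).
  rewrite /non_mono /= h55 h13 h35 h23.
  by do !(case: (f _ _) => //=).
have h46 : f 4 6 = false.
  move: (nm 1 4 3 3 isT) (nm 3 2 5 2 isT) (nm 1 5 2 3 isT)
    (nm 4 2 6 1 isT).
  rewrite /non_mono /= h55 h13 h35 h12.
  by do !(case: (f _ _) => //=).
(* Forced in turn: (1, 4) black, (2, 5) white, (3, 4) and (6, 8) black, (3, 6) white, (5, 7), (3, 8)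
   and (9, 7) black, (6, 1) white, (8, 9) black. Then (5, 7), (3, 8), (8, 9) are all black. *)
move: (nm 1 3 4 1 isT) (nm 1 1 3 1 isT) (nm 1 3 2 2 isT)
  (nm 1 5 2 3 isT) (nm 3 3 4 2 isT) (nm 2 3 5 1 isT)
  (nm 1 2 2 3 isT) (nm 5 4 5 1 isT) (nm 6 3 1 3 isT)
  (nm 6 2 1 4 isT) (nm 5 3 7 1 isT).
rewrite /non_mono /= h55 h13 h35 h12 h46.
by do !(case: (f _ _) => //=).
Qed.

Lemma coloring9_not_mono_free (f : nat -> nat -> bool) : ~~ mono_free 9 f.
Proof.
have [w | /negbTE] := boolP (f 5 5); last exact: coloring9_white_not_mono_free.
(* Swapping the two colours preserves monochromatic triples. *)
suff -> : mono_free 9 f = mono_free 9 (fun i j => ~~ f i j).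
  by apply: coloring9_white_not_mono_free; rewrite w.
apply: eq_all => a; apply: eq_all => b; apply: eq_all => x; apply: eq_all => d.
congr (_ ==> _); rewrite /non_mono.
by case: (f a x); case: (f b (x + d)); case: (f (a + b) (x + 2 * d)).
Qed.

(** The inner lists are indexed by the first coordinate; the predecessors shift coordinates from
    base 1 to base 0. *)
Definition coloring8 (i j : nat) : bool :=
  nth false (nth [::]
    [:: [:: false; true; true; false; false; true; false; false];
        [:: false; true; true; false; false; true; true; false];
        [:: false; true; true; false; false; true; true; false];
        [:: false; true; true; false; false; true; true; false];
        [:: false; true; true; false; false; true; true; false];
        [:: false; true; true; false; false; true; true; false];
        [:: false; true; false; false; false; true; true; false];
        [:: false; false; false; false; true; true; true; false]]
    i.-1) j.-1.

Lemma coloring8_mono_free : mono_free 8 coloring8.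
Proof. by vm_compute. Qed.

Lemma ord2_eq (u v : 'I_2) : (u == ord0) = (v == ord0) -> u = v.
Proof.
move=> e; apply: val_inj; move: e.
by case: u v => [[|[|?]] ?] [[|[|?]] ?].
Qed.

Theorem theorem21 :
  forces_mono 9 /\ (forall n : nat, forces_mono n -> 9 <= n).
Proof.
split=> [c | n force].
  pose f i j := if (insub (i, j) : option (grid 9)) is Some p
                then c p == ord0 else false.
  have fE (p : grid 9) i j : val p = (i, j) -> f i j = (c p == ord0).
    by rewrite /f => <-; rewrite valK.
  have [a [b [x [d [[a0 b0 x0 d0] [hab hxd mono]]]]]] :=
    mono_freePn (coloring9_not_mono_free f).
  have pP : (1 <= (a, x).1 <= 9) && (1 <= (a, x).2 <= 9).
    by rewrite /= a0 x0 (leq_trans (leq_addr _ _) hab) (leq_trans (leq_addr _ _) hxd).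
  have qP : (1 <= (b, x + d).1 <= 9) && (1 <= (b, x + d).2 <= 9).
    rewrite /= b0 ltn_addr // (leq_trans (leq_addl _ _) hab) /=.
    by apply: leq_trans hxd; rewrite leq_add2l leq_pmull.
  have rP : (1 <= (a + b, x + 2 * d).1 <= 9) && (1 <= (a + b, x + 2 * d).2 <= 9).
    by rewrite /= hab hxd !ltn_addr.
  exists a, b, x, d; split=> //.
  pose p : grid 9 := exist _ (a, x) pP.
  pose q : grid 9 := exist _ (b, x + d) qP.
  pose r : grid 9 := exist _ (a + b, x + 2 * d) rP.
  exists p, q, r; split=> //.
  move: mono; rewrite /non_mono negbK (fE p) // (fE q) // (fE r) //.
  by case/andP=> /eqP pq /eqP qr; split; apply: ord2_eq.
rewrite ltnNge; apply/negP => n8.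
(* Restricting [coloring8] to the smaller grid handles every [n <= 8] at once. *)
have [a [b [x [d [[a0 b0 x0 d0] [p [q [r [[vp vq vr] [pq qr]]]]]]]]]] :=
  force (fun p => inord (coloring8 (val p).1 (val p).2)).
have /andP[/= /andP[_ hab] /andP[_ hxd]] := valP r; rewrite vr /= in hab hxd.
have /negP[] : non_mono coloring8 a b x d.
  apply: (mono_freeP coloring8_mono_free).
  by rewrite a0 b0 x0 d0 (leq_trans hab n8) (leq_trans hxd n8).
have inj : injective (fun t : bool => inord t : 'I_2).
  by move=> [] [] // /(congr1 val); rewrite /= !inordK.
by move: pq qr; rewrite vp vq vr => /inj-> /inj->; rewrite !eqxx.
Qed.
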